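(* Let $\mathcal{H}=\mathcal{G}=\mathbb{R}$, $f=0$, $g^*=0$ (that is, $g$ is the function with $g(0)=0$ and $g(y)=\infty$ for $y\neq 0$), and $L=1$ (so $\|L\|=1$), i.e., consider the saddle-point problem $\min_{x\in\mathbb{R}}\max_{y\in\mathbb{R}} xy$. Then for every $\theta>1/2$ and all $\tau,\sigma>0$ with $\tau\sigma\|L\|^2\ge 4/(1+2\theta)$, the Chambolle--Pock iteration with parameters $\tau,\sigma,\theta$ applied to this problem fails to converge in general: there exists an initial point $(x_0,y_0)\in\mathbb{R}^2$ for which the generated sequence $(x_k,y_k)_{k=0}^\infty$ does not converge.
   Context: For real Hilbert spaces $\mathcal{H},\mathcal{G}$, proper convex lower semicontinuous $f\colon\mathcal{H}\to\mathbb{R}\cup\{\infty\}$ and $g\colon\mathcal{G}\to\mathbb{R}\cup\{\infty\}$ with convex conjugate $g^*(u)=\sup_{y}(\langle u,y\rangle-g(y))$, and a bounded linear operator $L\colon\mathcal{H}\to\mathcal{G}$ with adjoint $L^*$, the Chambolle--Pock iteration for $\min_{x}\max_{y} f(x)+\langle Lx,y\rangle-g^*(y)$ is, for $k=0,1,2,\dots$, $$x_{k+1}=\mathrm{Prox}^{\tau}_{f}(x_k-\tau L^*y_k),\qquad y_{k+1}=\mathrm{Prox}^{\sigma}_{g^*}\bigl(y_k+\sigma L(x_{k+1}+\theta(x_{k+1}-x_k))\bigr),$$ where $\mathrm{Prox}^{\gamma}_{h}(x)=\operatorname{argmin}_{z}\left(h(z)+\frac{1}{2\gamma}\|z-x\|^2\right)$.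 In the case considered it reads $x_{k+1}=x_k-\tau y_k$, $y_{k+1}=y_k+\sigma(x_{k+1}+\theta(x_{k+1}-x_k))$. *)

(* Defs.v *)
From HB Require Import structures.
From mathcomp Require Import all_boot all_order all_algebra.
From mathcomp Require Import all_classical all_reals all_analysis.

Set Implicit Arguments.
Unset Strict Implicit.
Unset Printing Implicit Defensive.

Import Order.TTheory GRing.Theory Num.Theory.
Import numFieldNormedType.Exports.

Local Open Scope classical_set_scope.
Local Open Scope ring_scope.

(* A real Hilbert space is a complete normed module whose norm is induced by
   a symmetric bilinear form; positive definiteness follows from
   inner_normE. *)
HB.mixin Record isHilbert (R : realType) H of CompleteNormedModule R H := {
  inner : H -> H -> R;
  innerC : forall x y : H, inner x y = inner y x;
  innerPl : forall (a : R) (x y z : H),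
    inner (a *: x + y) z = a * inner x z + inner y z;
  inner_normE : forall x : H, `|x| ^+ 2 = inner x x
}.

#[short(type="hilbertType")]
HB.structure Definition Hilbert (R : realType) :=
  { H of isHilbert R H & CompleteNormedModule R H }.

Section RealLine.
Variable R : realType.

Let mulr_innerPl (a : R) (x y z : R^o) :
  (a *: x + y) * z = a * (x * z) + y * z.
Proof. by rewrite mulrDl mulrA. Qed.

Let mulr_inner_normE (x : R^o) : `|x| ^+ 2 = x * x.
Proof. by rewrite real_normK ?num_real// expr2. Qed.

HB.instance Definition _ :=
  @isHilbert.Build R R^o (fun x y : R => x * y) (@mulrC R)
    mulr_innerPl mulr_inner_normE.

End RealLine.

Section ChambollePock.
Variable R : realType.

Definition conjugate (G : hilbertType R) (g : G -> \bar R) (u : G) : \bar R :=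
  ereal_sup [set ((inner u y)%:E - g y)%E | y in [set: G]].

Definition prox_objective (H : hilbertType R) (gamma : R) (h : H -> \bar R)
    (x z : H) : \bar R :=
  (h z + ((2 * gamma)^-1 * `|z - x| ^+ 2)%:E)%E.

(* The default value 0 is returned only when there is no minimizer, which does
   not occur for gamma > 0 and h proper, convex and lower semicontinuous; the
   minimizer is then also unique. *)
Definition prox (H : hilbertType R) (gamma : R) (h : H -> \bar R) (x : H) : H :=
  xget 0 [set p | forall z : H,
    (prox_objective gamma h x p <= prox_objective gamma h x z)%E].

(* For L bounded, the vector selected here exists and is unique by the Riesz
   representation theorem. *)
Definition adjoint (H G : hilbertType R) (L : {linear H -> G}) (y : G) : H :=
  xget 0 [set u | forall x : H, inner (L x) y = inner x u].

Definition opnorm (H G : hilbertType R) (L : {linear H -> G}) : R :=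
  sup [set `|L x| | x in [set x : H | `|x| <= 1]].

Definition chambolle_pock_step (H G : hilbertType R) (f : H -> \bar R)
    (g : G -> \bar R) (L : {linear H -> G}) (tau sigma theta : R)
    (w : H * G) : H * G :=
  let x := w.1 in
  let y := w.2 in
  let x' := prox tau f (x - tau *: adjoint L y) in
  let y' := prox sigma (conjugate g)
              (y + sigma *: L (x' + theta *: (x' - x))) in
  (x', y').

Definition chambolle_pock (H G : hilbertType R) (f : H -> \bar R)
    (g : G -> \bar R) (L : {linear H -> G}) (tau sigma theta : R)
    (w0 : H * G) (k : nat) : H * G :=
  iter k (chambolle_pock_step f g L tau sigma theta) w0.

Definition indicator0 (G : hilbertType R) (y : G) : \bar R :=
  if y == 0 then 0%:E else +oo%E.

End ChambollePock.

(* Main.v *)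
(* In this case the iteration is linear, (x, y) |-> (x - tau y, sigma x + (1 - tau sigma (1 + theta)) y).
   The characteristic polynomial of its matrix takes the value
   4 - tau sigma (1 + 2 theta) <= 0 at -1, so there is a real eigenvalue
   lambda <= -1; starting from an eigenvector, x_k = lambda ^ k has consecutive
   differences of absolute value at least 2. *)
Require Import Defs.
From HB Require Import structures.
From mathcomp Require Import all_boot all_order all_algebra.
From mathcomp Require Import all_classical all_reals all_analysis.
From mathcomp Require Import ring lra.

Set Implicit Arguments.
Unset Strict Implicit.
Unset Printing Implicit Defensive.

Import Order.TTheory GRing.Theory Num.Theory.
Import numFieldNormedType.Exports.

Local Open Scope classical_set_scope.
Local Open Scope ring_scope.

Lemma prox_cst0 (R : realType) (H : hilbertType R) (gamma : R) (x : H) :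
  0 < gamma -> prox gamma (fun=> 0%:E) x = x.
Proof.
move=> gamma_gt0; have c_gt0 : 0 < (2 * gamma)^-1 by rewrite invr_gt0 mulr_gt0.
(* Comparing any minimizer [p] with the competitor [x], where the objective is 0, forces
   [|p - x|^2 <= 0]; this gives uniqueness. *)
apply: xget_unique => [z | p /(_ x)]; rewrite /prox_objective !add0e lee_fin.
  by rewrite subrr normr0 expr0n mulr0 mulr_ge0 ?exprn_ge0// ltW.
rewrite subrr normr0 expr0n mulr0 pmulr_rle0// => le0.
apply/eqP; rewrite -subr_eq0 -normr_eq0 -sqrf_eq0.
by rewrite eq_le le0 exprn_ge0.
Qed.

Lemma inner0r (R : realType) (H : hilbertType R) (x : H) : inner x 0 = 0.
Proof.
rewrite innerC; have := innerPl 1 0 0 x.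
by rewrite scale1r addr0 mul1r => /eqP; rewrite addrC -subr_eq subrr => /eqP.
Qed.

(** Each [y != 0] contributes [-oo] to the supremum, so it is attained at [y = 0], with value
    [inner u 0 = 0]. *)
Lemma conjugate_indicator0 (R : realType) (G : hilbertType R) :
  conjugate (@indicator0 R G) = fun=> 0%:E.
Proof.
apply/funext => u; apply/eqP; rewrite eq_le; apply/andP; split.
  apply: ge_ereal_sup => _ [y _ <-]; rewrite /indicator0.
  by case: eqP => [->|_]; rewrite ?inner0r ?sube0 //= leNye.
apply: ereal_sup_ubound; exists 0 => //.
by rewrite /indicator0 eqxx inner0r sube0.
Qed.

Lemma adjoint_idfun (R : realType) (y : R^o) :
  adjoint (idfun : {linear R^o -> R^o}) y = y.
Proof.
(* Testing the defining identity at the vector 1 already determines [u]. *)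
apply: xget_unique => [//|u /(_ 1)].
by rewrite /inner /= !mul1r.
Qed.

Lemma opnorm_idfun (R : realType) :
  opnorm (idfun : {linear R^o -> R^o}) = 1.
Proof.
have ub1 : ubound [set `|(idfun : {linear R^o -> R^o}) x|
                  | x in [set x : R^o | `|x| <= 1]] (1 : R).
  by move=> _ [x /= x1 <-].
have mem1 : [set `|(idfun : {linear R^o -> R^o}) x|
            | x in [set x : R^o | `|x| <= 1]] (1 : R).
  by exists 1 => /=; rewrite normr1.
apply/eqP; rewrite eq_le; apply/andP; split.
  by apply: ge_sup => //; exists 1.
by apply: ub_le_sup => //; exists 1.
Qed.

Lemma chambolle_pock_step_bilinear (R : realType) (tau sigma theta : R)
    (w : R^o * R^o) : 0 < tau -> 0 < sigma ->
  chambolle_pock_step (fun=> 0%:E) (@indicator0 R R^o)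
    (idfun : {linear R^o -> R^o}) tau sigma theta w =
  (w.1 - tau * w.2, sigma * w.1 + (1 - tau * sigma * (1 + theta)) * w.2).
Proof.
move=> tau0 sigma0; rewrite /chambolle_pock_step conjugate_indicator0.
rewrite !prox_cst0// adjoint_idfun /=; congr pair.
rewrite /GRing.scale /=; ring.
Qed.

Lemma root_le_m1 (R : rcfType) (t d : R) : 1 + t + d <= 0 ->
  exists2 l : R, l <= -1 & l ^+ 2 - t * l + d = 0.
Proof.
(* The right side minus the left is [-4 * (1 + t + d)]. Hence the discriminant is nonnegative and
   its root is at least [t + 2], which puts the smaller zero at or below -1. *)
move=> h; have hD : (t + 2) ^+ 2 <= t ^+ 2 - 4 * d by nra.
have D_ge0 := le_trans (sqr_ge0 _) hD.
exists ((t - Num.sqrt (t ^+ 2 - 4 * d)) / 2).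
  have : t + 2 <= Num.sqrt (t ^+ 2 - 4 * d).
    by rewrite (le_trans (ler_norm _))// -sqrtr_sqr ler_wsqrtr.
  lra.
have := sqr_sqrtr D_ge0; set s := Num.sqrt _ => hs.
have -> : d = (t ^+ 2 - s ^+ 2) / 4 by rewrite hs; field.
by field.
Qed.

Lemma expr_le_m1_not_cvg (R : realType) (l a : R) :
  l <= -1 -> ~ (l ^+ k @[k --> \oo] --> a).
Proof.
move=> l_le cvl.
have cvlS : l ^+ k.+1 @[k --> \oo] --> a.
  by move: cvl; rewrite -cvg_shiftS.
have cvd : (l ^+ k.+1 - l ^+ k) @[k --> \oo] --> (0 : R).
  by rewrite -(subrr a); exact: cvgB.
have [N _ /(_ N (leqnn N)) /=] : \forall k \near \oo, `|l ^+ k.+1 - l ^+ k| < 2.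
  by apply: cvgr0_norm_lt.
apply/negP; rewrite -leNgt.
(* The difference factors as [(l - 1) * l ^ N], with factors of absolute value at least 2 and 1. *)
rewrite exprS -[X in _ - X]mul1r -mulrBl normrM normrX.
have l_ge1 : 1 <= `|l| by rewrite ler0_norm; lra.
have l1_ge2 : 2 <= `|l - 1| by rewrite ler0_norm; lra.
by rewrite -[2]mulr1 ler_pM// exprn_ege1.
Qed.

Theorem mainTheorem3 (R : realType) (theta tau sigma : R) :
  let f : R^o -> \bar R := fun=> 0%:E in
  let g : R^o -> \bar R := @indicator0 R R^o in
  let L : {linear R^o -> R^o} := idfun in
  1 / 2 < theta -> 0 < tau -> 0 < sigma ->
  4 / (1 + 2 * theta) <= tau * sigma * opnorm L ^+ 2 ->
  exists w0 : R^o * R^o,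
    ~ exists w : R^o * R^o, chambolle_pock f g L tau sigma theta w0 @ \oo --> w.
Proof.
move=> f g L theta_gt tau0 sigma0.
rewrite opnorm_idfun expr1n mulr1 ler_pdivrMr; last by lra.
move=> hs.
(* The two arguments are the trace and the determinant of the iteration matrix. *)
have [l l_le hl] := @root_le_m1 R (2 - tau * sigma * (1 + theta))
  (1 - tau * sigma * theta) ltac:(lra).
(* With first coordinate 1, the first row of the eigenvector equation reads [1 - tau * y = l]. *)
exists (1, (1 - l) / tau) => -[[x y] cvw].
have iterE k : chambolle_pock f g L tau sigma theta (1, (1 - l) / tau) k =
    (l ^+ k, l ^+ k * ((1 - l) / tau)).
  elim: k => [|k IH]; first by rewrite expr0 mul1r.
  rewrite /chambolle_pock iterS -/(chambolle_pock _ _ _ _ _ _ _ _) IH.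
  rewrite chambolle_pock_step_bilinear//= exprS; congr pair.
    by field; rewrite gt_eqF.
  (* In the second row, the two sides differ by [tau^-1 * l ^+ k] times the characteristic
     polynomial at [l]. *)
  have : l ^+ k * (l ^+ 2 - (2 - tau * sigma * (1 + theta)) * l
     + (1 - tau * sigma * theta)) = 0 by rewrite hl mulr0.
  move=> e; apply/eqP; rewrite -subr_eq0 -(mulr0 (tau^-1)) -e; apply/eqP.
  by field; rewrite gt_eqF.
apply: (@expr_le_m1_not_cvg R l x l_le).
(* A limit of the pairs would give a limit of their first coordinates [l ^+ k]. *)
have -> : (fun k => l ^+ k) =
    fst \o chambolle_pock f g L tau sigma theta (1, (1 - l) / tau).
  by apply/funext => k; rewrite /= iterE.
by apply: cvg_comp cvw _; exact: cvg_fst.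
Qed.
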